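(* Let $L=[a,b]$ be a closed interval of $\overline{\mathbb{R}}=\mathbb{R}\cup\{-\infty,+\infty\}$, let $n\geqslant 1$, let $X_1,\ldots,X_n$ be independent $L$-valued random variables, $X_i$ having cumulative distribution function $F_i$. Let $p:L^n\to L$ be any weighted lattice polynomial function, let $Y_p:=p(X_1,\ldots,X_n)$ have cumulative distribution function $F_p$, and let $g:\overline{\mathbb{R}}\to\overline{\mathbb{R}}$ be any measurable function of bounded variation. (1) If $\lim_{y\to\infty}g(y)[1-F_i(y)]=0$ for all $i\in [n]$, then $$\mathbf{E}[g(Y_p)]= g(-\infty)+\int_{-\infty}^{\infty}[1-F_p(y)] \,\mathrm{d} g(y).$$ (2) If $\lim_{y\to -\infty}g(y)F_i(y)=0$ for all $i\in [n]$, then $$\mathbf{E}[g(Y_p)]=g(\infty)-\int_{-\infty}^{\infty}F_p(y) \,\mathrm{d} g(y).$$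
   Context: Notation: $[n]=\{1,\ldots,n\}$; $\wedge=\min$, $\vee=\max$. The class of weighted lattice polynomial functions from $L^n$ to $L$ is the smallest class of functions $L^n\to L$ that contains all projections $(x_1,\ldots,x_n)\mapsto x_k$ ($k\in[n]$) and all constant functions $(x_1,\ldots,x_n)\mapsto c$ ($c\in L$), and is closed under pointwise $\wedge$ and pointwise $\vee$. Cumulative distribution functions are $F_i(y)=\Pr[X_i\leqslant y]$ and $F_p(y)=\Pr[Y_p\leqslant y]$. The expected value is, by definition, the Stieltjes integral $\mathbf{E}[g(Y_p)]=\int_{-\infty}^{\infty}g(y)\,\mathrm{d}F_p(y)$, and integrals $\int\cdots\,\mathrm{d}g(y)$ are likewise Stieltjes integrals with respect to $g$.
   Formalization: Assumes one of the two Stieltjes integrals in the formula exists over [-∞,∞] (it fails for X=0, g=1_{[0,∞]}); bounded variation means finite total variation on the whole extended line, so g is bounded; E[g(Y_p)] as an integral dF_p includes the term g(-∞)F_p(-∞). *)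

(* Defs.v *)
From HB Require Import structures.
From mathcomp Require Import all_boot all_order all_algebra.
From mathcomp Require Import all_classical all_reals all_analysis.
From mathcomp Require Import measurable_realfun.
Set Implicit Arguments.
Unset Strict Implicit.
Unset Printing Implicit Defensive.
Import Order.TTheory GRing.Theory Num.Theory.
Import numFieldNormedType.Exports.

Local Open Scope classical_set_scope.
Local Open Scope ring_scope.
Local Open Scope ereal_scope.

Definition eitv (R : realType) (a b : \bar R) : Type :=
  {x : \bar R | x \in `[a, b]}.

#[local] Set Warnings "-redundant-canonical-projection".
HB.instance Definition _ (R : realType) (a b : \bar R) :=
  SubChoice.on (eitv a b).
HB.instance Definition _ (R : realType) (a b : \bar R) :=
  [SubChoice_isSubOrder of eitv a b by <: with ereal_display].

(* Weighted lattice polynomial functions L^n -> L: Order.min and Order.max are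
   the meet and the join of the chain L. *)
Inductive wlp d (L : orderType d) (n : nat) : (('I_n -> L) -> L) -> Prop :=
| wlp_proj (k : 'I_n) : wlp (fun x => x k)
| wlp_cst (c : L) : wlp (fun=> c)
| wlp_min p q : wlp p -> wlp q -> wlp (fun x => Order.min (p x) (q x))
| wlp_max p q : wlp p -> wlp q -> wlp (fun x => Order.max (p x) (q x)).

Definition independent_family (d : measure_display) (T : measurableType d)
    (R : realType) (P : probability T R) (n : nat) (X : 'I_n -> T -> \bar R) :
    Prop :=
  forall (J : {set 'I_n}) (B : 'I_n -> set (\bar R)),
    (forall i, measurable (B i)) ->
    P (\bigcap_(i in [set` J]) (X i @^-1` B i)) =
    \prod_(i in J) P (X i @^-1` B i).

(* Distribution function on the extended line; its value at -oo is the mass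
   of -oo, and the mass of +oo is its jump at +oo. *)
Definition ecdf (d : measure_display) (T : measurableType d) (R : realType)
    (P : probability T R) (Y : T -> \bar R) (y : \bar R) : \bar R :=
  P [set w | Y w <= y].

(* A subdivision -oo = x_0 <= x_1 <= ... <= x_m = +oo of [-oo, +oo] is
   represented by s = [:: x_1; ...; x_m]; the point x_0 is omitted. *)
Definition subdivision (R : realType) (s : seq (\bar R)) : Prop :=
  path <=%O -oo s /\ last -oo s = +oo.

Definition node (R : realType) (s : seq (\bar R)) (i : nat) : \bar R :=
  nth +oo (-oo :: s) i.

Definition evariation (R : realType) (g : \bar R -> \bar R)
    (s : seq (\bar R)) : \bar R :=
  \sum_(i < size s) `|g (node s i.+1) - g (node s i)|.

(* Since `|+oo - +oo| = +oo in \bar R, this forces g to be finite-valued. *)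
Definition bounded_evariation (R : realType) (g : \bar R -> \bar R) : Prop :=
  exists M : R, forall s, subdivision s -> evariation g s <= M%:E.

(* A pair (s, t) of a subdivision and a sequence of tags. *)
Definition tagged_subdivision (R : realType)
    (st : seq (\bar R) * seq (\bar R)) : Prop :=
  [/\ subdivision st.1, size st.2 = size st.1 &
      forall i, (i < size st.1)%N ->
        node st.1 i <= nth +oo st.2 i <= node st.1 i.+1].

Definition stieltjes_sum (R : realType) (f g : \bar R -> \bar R)
    (st : seq (\bar R) * seq (\bar R)) : \bar R :=
  \sum_(i < size st.1)
    f (nth +oo st.2 i) * (g (node st.1 i.+1) - g (node st.1 i)).

(* The tagged subdivisions directed by refinement. *)
Definition refinement (R : realType) :
    set_system (seq (\bar R) * seq (\bar R)) :=
  filter_from (@subdivision R)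
    (fun s0 => [set st | tagged_subdivision st /\ {subset s0 <= st.1}]).

(* The Riemann-Stieltjes integral of f with respect to g over [-oo, +oo], as
   the limit of the sums along refinement: [-oo, +oo] has no mesh. It may fail
   to exist when f and g jump at the same point. *)
Definition stieltjes_integrable (R : realType) (f g : \bar R -> \bar R) : Prop :=
  cvg (stieltjes_sum f g @ @refinement R).

Definition stieltjes (R : realType) (f g : \bar R -> \bar R) : \bar R :=
  lim (stieltjes_sum f g @ @refinement R).

(* Integration with respect to a distribution function on [-oo, +oo]: the
   increments of F over a subdivision do not see the mass F -oo of -oo, so its
   contribution is added. The added term vanishes when F -oo = 0. *)
Definition stieltjes_cdf (R : realType) (g F : \bar R -> \bar R) : \bar R :=
  g -oo * F -oo + stieltjes g F.

(* Main.v *)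
(* A function g of bounded variation is finite and bounded, so all the sums
   below are real. If the sums of g against the distribution function of a
   random variable Y converge along refinement, their limit is the integral of
   g(Y) over {Y > -oo}: in each slice {x_i < Y <= x_{i+1}} a tag can be chosen
   so that its term is at most, or at least, the integral over the slice, up to
   e times the probability of the slice. Abel summation over the subdivision
   made of the points and the tags turns sums of g against F into sums of F
   against g, which transfers both existence and value. *)
Require Import Defs.
From HB Require Import structures.
From mathcomp Require Import all_boot all_order all_algebra.
From mathcomp Require Import all_classical all_reals all_analysis.
From mathcomp Require Import measurable_realfun.
From mathcomp Require Import ring lra.
Set Implicit Arguments.
Unset Strict Implicit.
Unset Printing Implicit Defensive.
Import Order.TTheory GRing.Theory Num.Theory.
Import numFieldNormedType.Exports.

Local Open Scope classical_set_scope.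
Local Open Scope ring_scope.

(** * Recursive sums over tagged subdivisions and Abel summation *)

Section tagged_sums.
Context {R : realType}.
Implicit Types (f g h F : \bar R -> R) (x y u : \bar R) (s t : seq (\bar R)).

(** Real-valued form of [stieltjes_sum] with the starting point [x] as an argument, so that
    inductions can move it. The default [+oo] of [head] matches that of [nth] in [stieltjes_sum]. *)
Fixpoint rsum f g x s t : R :=
  if s is y :: s' then
    f (head +oo%E t) * (g y - g x) + rsum f g y s' (behead t)
  else 0.

Fixpoint tags x s t : bool :=
  match s, t with
  | [::], [::] => true
  | y :: s', u :: t' => [&& (x <= u)%E, (u <= y)%E & tags y s' t']
  | _, _ => false
  end.

Lemma stieltjes_sumE f g st :
  stieltjes_sum (EFin \o f) (EFin \o g) st = (rsum f g -oo%E st.1 st.2)%:E.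
Proof.
case: st => s t; rewrite /stieltjes_sum /node /=.
elim: s -oo%E t => [|y s IH] x t; first by rewrite big_ord0.
rewrite big_ord_recl /= EFinD EFinM EFinB -nth0; congr (_ + _)%E.
by rewrite -IH; apply: eq_bigr => i _; rewrite nth_behead.
Qed.

Lemma tagsP x s t :
  tags x s t <-> size t = size s /\
    forall i, (i < size s)%N ->
      (nth +oo (x :: s) i <= nth +oo t i <= nth +oo (x :: s) i.+1)%E.
Proof.
elim: s x t => [|y s IH] x [|u t] /=; split => //; try by case.
- case/and3P => xu uy /IH[-> H]; split => // -[|i] /= i_s; last exact: H.
  by rewrite xu uy.
- case=> -[ts] H; have /= /andP[-> ->] := H 0%N isT.
  by apply/IH; split=> // i i_s; exact: (H i.+1).
Qed.

Lemma tags_path x s t : tags x s t -> path <=%O x s.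
Proof.
elim: s x t => [//|y s IH] x [//|u t] /= /and3P[xu uy /IH ->].
by rewrite (le_trans xu uy).
Qed.

Lemma path_tags x s : path <=%O x s -> tags x s s.
Proof. by elim: s x => [//|y s IH] x /= /andP[-> /IH ->]; rewrite lexx. Qed.

Lemma tagged_subdivisionP s t :
  tagged_subdivision (s, t) <-> tags -oo%E s t /\ last -oo%E s = +oo%E.
Proof.
split=> [[[_ ls] ts H]|[tst ls]]; first by split=> //; apply/tagsP.
by have /tagsP[ts H] := tst; split=> //; split=> //; exact: tags_path tst.
Qed.

(** When [t] tags [s], this is a finer subdivision with the tags as additional points. It is tagged
    by [endpoints]: the step from [x] to [u] gets [x], the step from [u] to [y] gets [y]. *)
Fixpoint interleave s t : seq (\bar R) :=
  match s, t with y :: s', u :: t' => u :: y :: interleave s' t' | _, _ => [::] end.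

Fixpoint endpoints x s : seq (\bar R) :=
  if s is y :: s' then x :: y :: endpoints y s' else [::].

Lemma interleave_tags x s t :
  tags x s t -> tags x (interleave s t) (endpoints x s).
Proof.
elim: s x t => [|y s IH] x [|u t] //= /and3P[xu uy /IH ->].
by rewrite lexx xu uy lexx.
Qed.

Lemma last_interleave x s t : tags x s t -> last x (interleave s t) = last x s.
Proof. by elim: s x t => [|y s IH] x [|u t] //= /and3P[_ _ /IH]. Qed.

Lemma sub_interleave x s t : tags x s t -> {subset s <= interleave s t}.
Proof.
elim: s x t => [|y s IH] x [|u t] //= /and3P[_ _ /IH sub] z.
by rewrite !inE => /orP[/eqP -> |/sub ->]; rewrite ?eqxx ?orbT.
Qed.

(* Abel summation: the points of the subdivision and the tags exchange roles. *)
Lemma rsum_parts f g x s t : tags x s t ->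
  rsum f g x s t + rsum g f x (interleave s t) (endpoints x s) =
  f (last x s) * g (last x s) - f x * g x.
Proof.
elim: s x t => [|y s IH] x [|u t] //=; first by rewrite addr0 subrr.
move=> /and3P[_ _ /IH {}IH].
by move: IH; set a := rsum _ _ _ _ _; set b := rsum _ _ _ _ _ => ?; lra.
Qed.

Lemma rsum_opp f g x s t : rsum (fun y => - f y) g x s t = - rsum f g x s t.
Proof. by elim: s x t => [|y s IH] x t /=; rewrite ?oppr0// IH opprD mulNr. Qed.

Lemma rsum_1sub f g x s t :
  rsum (fun y => 1 - f y) g x s t = g (last x s) - g x - rsum f g x s t.
Proof.
elim: s x t => [|y s IH] x t /=; first by rewrite subr0 subrr.
by rewrite IH; lra.
Qed.

(** The increments of a nondecreasing [g] are nonnegative, so the bounds on the terms telescope. *)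
Lemma rsum_bound f g (K : R) x s t : (forall y, `|f y| <= K) ->
  {homo g : y z / (y <= z)%E >-> y <= z} -> path <=%O x s ->
  `|rsum f g x s t| <= K * (g (last x s) - g x).
Proof.
move=> fK ndg; elim: s x t => [|y s IH] x t /=.
  by rewrite normr0 subrr mulr0.
case/andP => xy /IH {}IH; rewrite (le_trans (ler_normD _ _))//.
have -> : K * (g (last y s) - g x) =
    K * (g y - g x) + K * (g (last y s) - g y) by ring.
rewrite lerD// normrM; have /ndg gxy := xy.
by rewrite (@ger0_norm _ (_ - _)) ?subr_ge0// ler_wpM2r ?subr_ge0.
Qed.

End tagged_sums.

(** * The filter of refinements *)

Lemma path_le_last d (T : porderType d) (x z : T) s :
  path <=%O x s -> z \in x :: s -> (z <= last x s)%O.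
Proof.
elim: s x z => [|y s IH] x z; first by rewrite inE => _ /eqP ->.
rewrite inE => /andP[xy ys] /orP[/eqP ->|]; last exact: IH.
by apply: le_trans xy _; apply: IH ys _; exact: mem_head.
Qed.

Section refinement_filter.
Context {R : realType}.

(** Merging and sorting two subdivisions gives a common refinement; tagging a subdivision by its own
    points shows that no base set is empty. *)
Lemma refinement_filter : ProperFilter (@refinement R).
Proof.
apply: filter_from_proper; last first.
  move=> s [ps ls]; exists (s, s); split=> //.
  by apply/tagged_subdivisionP; split=> //; exact: path_tags.
apply: filter_from_filter.
  by exists [:: +oo%E]; split => //=; rewrite leey.
move=> s1 s2 [p1 l1] [p2 l2]; pose m := sort <=%O (s1 ++ s2).
have subm : {subset s1 ++ s2 <= m} by move=> z; rewrite mem_sort.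
exists m; last first.
  by move=> st [tst sub]; split; split=> // z zs;
    apply/sub/subm; rewrite mem_cat zs ?orbT.
have pm : path <=%O -oo%E m.
  have : all (<=%O -oo%E) m by apply/seq.allP => z _; rewrite /= leNye.
  move=> /path_min_sorted ->; apply: sort_sorted; exact: le_total.
split=> //; apply/eqP; rewrite -leye_eq.
(* A sorted list that contains [+oo] must end there. *)
have oo_m : +oo%E \in -oo%E :: m.
  by rewrite inE subm ?orbT// mem_cat -l1; case: (s1) l1 => //= y s _;
    rewrite mem_last.
exact: path_le_last pm oo_m.
Qed.

Lemma near_refinement (Q : set (seq (\bar R) * seq (\bar R))) :
  (\forall st \near @refinement R, Q st) <->
  exists2 s0, subdivision s0 & forall s t, tags -oo%E s t ->
    last -oo%E s = +oo%E -> {subset s0 <= s} -> Q (s, t).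
Proof.
split=> -[s0 h0 H]; exists s0 => //.
  by move=> s t st ls sub; apply: H; split=> //; apply/tagged_subdivisionP.
by move=> [s t] [/tagged_subdivisionP[st ls] sub]; exact: H.
Qed.

End refinement_filter.

#[local] Existing Instance refinement_filter.

(** * Limits of sums: integration by parts and complements *)

Section limits_of_sums.
Context {R : realType}.
Implicit Types (f g : \bar R -> R) (l : R).

Definition real_stieltjes_sum f g (st : seq (\bar R) * seq (\bar R)) : R :=
  rsum f g -oo%E st.1 st.2.

(** [stieltjes_integrable] is convergence in [\bar R], which allows infinite limits; a common bound
    on all sums rules them out. *)
Definition bounded_sums f g : Prop :=
  exists K, forall s t, tags -oo%E s t -> last -oo%E s = +oo%E ->
    `|real_stieltjes_sum f g (s, t)| <= K.

Lemma real_stieltjes_sum_parts f g s t :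
  tags -oo%E s t -> last -oo%E s = +oo%E ->
  real_stieltjes_sum f g (s, t) = f +oo%E * g +oo%E - f -oo%E * g -oo%E -
    real_stieltjes_sum g f (interleave s t, endpoints -oo%E s).
Proof.
rewrite /real_stieltjes_sum /= => st <-.
by rewrite -(rsum_parts f g st) addrK.
Qed.

Lemma real_stieltjes_sum_1sub f g s t : last -oo%E s = +oo%E ->
  real_stieltjes_sum (fun y => 1 - f y) g (s, t) =
  g +oo%E - g -oo%E - real_stieltjes_sum f g (s, t).
Proof. by move=> <-; exact: rsum_1sub. Qed.

Lemma bounded_sumsC f g : bounded_sums f g -> bounded_sums g f.
Proof.
case=> K fgK; set c := g +oo%E * f +oo%E - g -oo%E * f -oo%E.
exists (`|c| + K) => s t st ls; rewrite real_stieltjes_sum_parts//.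
rewrite (le_trans (ler_normB _ _))// lerD2l.
by apply: fgK; [exact: interleave_tags|rewrite last_interleave].
Qed.

Lemma bounded_sums_1sub f g :
  bounded_sums f g -> bounded_sums (fun y => 1 - f y) g.
Proof.
case=> K fgK; exists (`|g +oo%E - g -oo%E| + K) => s t st ls.
rewrite real_stieltjes_sum_1sub// (le_trans (ler_normB _ _))// lerD2l.
exact: fgK.
Qed.

Lemma stieltjes_sum_EFin f g :
  stieltjes_sum (EFin \o f) (EFin \o g) = EFin \o real_stieltjes_sum f g.
Proof. by apply/funext => st; rewrite stieltjes_sumE. Qed.

Lemma stieltjes_integrable_cvg f g : bounded_sums f g ->
  stieltjes_integrable (EFin \o f) (EFin \o g) ->
  exists l, real_stieltjes_sum f g @ @refinement R --> l.
Proof.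
move=> [K fgK]; rewrite /stieltjes_integrable stieltjes_sum_EFin.
have bnd : \forall st \near @refinement R, `|real_stieltjes_sum f g st| <= K.
  apply/near_refinement; exists [:: +oo%E]; first by split=> //=; rewrite leey.
  by move=> s t st ls _; exact: fgK.
case/cvg_ex => -[l||].
- by move=> /fine_cvgP[_ cl]; exists l.
- move/cvgeyPge => /(_ (K + 1)) ge.
  have [st [/=]] := filter_ex (filterI bnd ge).
  by rewrite lee_fin => /ler_normlW; lra.
- move/cvgeNyPle => /(_ (- K - 1)) le.
  have [st [/=]] := filter_ex (filterI bnd le).
  by rewrite lee_fin ler_norml => /andP[? _]; lra.
Qed.

Lemma cvg_stieltjes f g l : real_stieltjes_sum f g @ @refinement R --> l ->
  stieltjes_integrable (EFin \o f) (EFin \o g) /\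
  stieltjes (EFin \o f) (EFin \o g) = l%:E.
Proof.
move=> fgl; have cl : EFin \o real_stieltjes_sum f g @ @refinement R --> l%:E.
  by apply: cvg_EFin => //; exact: nearW.
rewrite /stieltjes_integrable /stieltjes stieltjes_sum_EFin; split.
  by apply/cvg_ex; exists l%:E.
by apply/cvg_lim.
Qed.

(** Interleaving only adds points, so a subdivision finer than [s0] stays finer than [s0], and the
    sum of [f] against [g] produced by Abel summation is still close to [l]. *)
Lemma real_stieltjes_cvg_parts f g l :
  real_stieltjes_sum f g @ @refinement R --> l ->
  real_stieltjes_sum g f @ @refinement R -->
    f +oo%E * g +oo%E - f -oo%E * g -oo%E - l.
Proof.
move=> /cvgrPdist_le fgl; apply/cvgrPdist_le => e /fgl.
move=> /near_refinement[s0 s0P H]; apply/near_refinement.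
exists s0 => // s t st ls sub; rewrite real_stieltjes_sum_parts//.
rewrite distrC (_ : _ - _ =
  l - real_stieltjes_sum f g (interleave s t, endpoints -oo%E s)); last by ring.
apply: H; first exact: interleave_tags.
- by rewrite last_interleave.
- by move=> z /sub; exact: (sub_interleave st).
Qed.

Lemma real_stieltjes_cvg_1sub f g l :
  real_stieltjes_sum f g @ @refinement R --> l ->
  real_stieltjes_sum (fun y => 1 - f y) g @ @refinement R -->
    g +oo%E - g -oo%E - l.
Proof.
move=> /cvgrPdist_le fgl; apply/cvgrPdist_le => e /fgl.
move=> /near_refinement[s0 s0P H]; apply/near_refinement.
exists s0 => // s t st ls sub; rewrite real_stieltjes_sum_1sub//.
rewrite distrC (_ : _ - _ = l - real_stieltjes_sum f g (s, t)); last by ring.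
exact: H.
Qed.

End limits_of_sums.

(** * Sums against a distribution function and integrals over slices *)

Section law_integral.
Context d (T : measurableType d) (R : realType) (P : probability T R).
Variable Y : T -> \bar R.
Hypothesis mY : measurable_fun setT Y.

Let cdf y : R := fine (ecdf P Y y).
(** Open on the left and closed on the right, so that its probability is the increment of [cdf] and
    consecutive slices are disjoint. *)
Let slice x y : set T := [set w | (x < Y w <= y)%E].

Let measurable_sublevel y : measurable [set w | (Y w <= y)%E].
Proof. by rewrite -[X in measurable X]setTI; exact: emeasurable_fun_infty_c. Qed.

Let sliceE x y :
  slice x y = [set w | (Y w <= y)%E] `\` [set w | (Y w <= x)%E].
Proof.
apply/seteqP; rewrite /slice; split=> w /=.
  by rewrite ltNge => /andP[/negP].
by case=> -> /negP; rewrite -ltNge => ->.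
Qed.

Let measurable_slice x y : measurable (slice x y).
Proof. by rewrite sliceE; exact: measurableD. Qed.

Lemma ecdf_fin_num y : ecdf P Y y \is a fin_num.
Proof. exact: fin_num_measure. Qed.

Lemma fine_ecdf_slice x y : (x <= y)%E -> fine (P (slice x y)) = cdf y - cdf x.
Proof.
move=> xy; rewrite sliceE measureD//; last first.
  by rewrite ltey_eq fin_num_measure.
rewrite setIidr; last by move=> w /= /le_trans; exact.
by rewrite fineB ?fin_num_measure.
Qed.

Lemma fine_ecdf_homo : {homo cdf : x y / (x <= y)%E >-> x <= y}.
Proof. by move=> x y xy; rewrite -subr_ge0 -fine_ecdf_slice// fine_ge0. Qed.

Lemma integrable_bounded (f : T -> R) (K : R) (A : set T) : measurable A ->
  measurable_fun setT f -> (forall w, `|f w| <= K) ->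
  P.-integrable A (EFin \o f).
Proof.
move=> mA mf fK; apply: measurable_bounded_integrable => //.
- by rewrite ltey_eq fin_num_measure.
- exact: measurable_funTS.
- exists K; split; first exact: num_real.
  by move=> x Kx w _ /=; apply: le_trans (fK w) _; exact: ltW.
Qed.

Section lower_tags.
Variables (h : \bar R -> R) (K : R).
Hypothesis mh : measurable_fun setT (h \o Y).
Hypothesis hK : forall y, `|h y| <= K.

Let integrable_h A : measurable A -> P.-integrable A (EFin \o (h \o Y)).
Proof. by move=> mA; apply: (integrable_bounded mA mh) => w; exact: hK. Qed.

(* If every value of h on [x, y] exceeded its mean over the slice by e, so
   would the mean. *)
Lemma tag_le x y (e : R) : 0 < e -> (x <= y)%E ->
  exists u, [/\ (x <= u)%E, (u <= y)%E &
    h u * (cdf y - cdf x) <=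
    \int[P]_(w in slice x y) h (Y w) + e * (cdf y - cdf x)].
Proof.
move=> e0 xy; apply: contrapT => /forallNP N.
set c := cdf y - cdf x in N; set I := \int[P]_(w in slice x y) h (Y w) in N.
have c0 : 0 <= c by rewrite subr_ge0 fine_ecdf_homo.
have hc u : (x <= u)%E -> (u <= y)%E -> I + e * c < h u * c.
  by move=> xu uy; rewrite ltNge; apply/negP => ?; exact: (N u).
(* This is [hc] integrated over the slice, of probability [c]. Keeping the factor [c] avoids
   dividing by a probability that may vanish. *)
have : (I + e * c) * c <= I * c.
  rewrite -[X in _ * X <= _](fine_ecdf_slice xy) -Rintegral_cst//.
  rewrite -RintegralZr//; last exact: integrable_h.
  apply: le_Rintegral => //.
  - exact: (@integrable_bounded _ `|I + e * c|).
  - apply: (@integrable_bounded _ (K * c)) => //.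
      by apply: measurable_funM => //; exact: measurable_cst.
    by move=> w; rewrite normrM (ger0_norm c0) ler_wpM2r.
  - by move=> w /= /andP[/ltW xw wy]; rewrite ltW ?hc.
have [c_gt0|] := ltP 0 c; first by rewrite ler_pM2r//; nra.
(* On a null slice the integral is 0, and [hc] at [x] reads [0 < 0]. *)
move=> c_le0 _; have {}c0 : c = 0 by apply/eqP; rewrite eq_le c_le0.
have := hc x (lexx _) xy; rewrite c0 !mulr0 addr0 /I /Rintegral.
rewrite null_set_integral ?ltxx//=.
  by apply/measurable_EFinP; exact: measurable_funTS.
by apply/eqP; rewrite -fine_eq0 ?fin_num_measure// fine_ecdf_slice// -/c c0.
Qed.

(** Each error is [e] times the probability of its slice, so the total error does not grow with the
    number of points. *)
Lemma tags_le x s (e : R) : 0 < e -> path <=%O x s ->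
  exists2 t, tags x s t & rsum h cdf x s t <=
    \int[P]_(w in slice x (last x s)) h (Y w) + e * (cdf (last x s) - cdf x).
Proof.
move=> e0; elim: s x => [|y s IH] x /=.
  exists [::] => //; rewrite subrr mulr0 addr0 (_ : slice _ _ = set0).
    by rewrite Rintegral_set0.
  by apply/seteqP; split=> w //= /andP[/lt_le_trans xw /xw]; rewrite ltxx.
case/andP => xy ys; have [t tst le_t] := IH _ ys.
have [u [xu uy le_u]] := tag_le e0 xy.
exists (u :: t); rewrite /= ?xu ?uy//.
have -> : slice x (last y s) = slice x y `|` slice y (last y s).
  have yl : (y <= last y s)%E by apply: path_le_last ys _; exact: mem_head.
  apply/seteqP; split=> w /=; rewrite /slice /=.
    by case/andP=> -> ->; rewrite andbT /=; case: leP => _; [left|right].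
  case=> /andP[]; first by move=> -> /= /le_trans; exact.
  by move=> /(le_lt_trans xy) -> ->.
rewrite Rintegral_setU//; last 2 first.
- by apply: integrable_h; exact: measurableU.
- rewrite disj_set2E; apply/eqP/seteqP; split=> w //= [/andP[_ wy] /andP[]].
  by rewrite ltNge wy.
by rewrite (le_trans (lerD le_u le_t))//; lra.
Qed.

(** Convergence along refinement is uniform in the tags, so it applies to the tags from [tags_le] on
    one fine enough subdivision. *)
Lemma limit_le_Rintegral l :
  real_stieltjes_sum h cdf @ @refinement R --> l ->
  l <= \int[P]_(w in slice -oo%E +oo%E) h (Y w).
Proof.
move=> /cvgrPdist_le hl; apply/ler_addgt0Pr => e e0.
(* One half bounds the distance from the sum to [l], the other the error of the tags, whose factor
   is a probability and hence at most 1. *)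
have e2 : 0 < e / 2 by rewrite divr_gt0.
have /near_refinement[s [ps ls] near_l] := hl _ e2.
have [t st le_t] := tags_le e2 ps; rewrite ls in le_t.
have := near_l _ _ st ls (fun _ => id); move: le_t.
rewrite /real_stieltjes_sum /= -fine_ecdf_slice ?leey//.
have : fine (P (slice -oo%E +oo%E)) <= 1.
  by rewrite -lee_fin fineK ?fin_num_measure// probability_le1.
rewrite ler_norml => ? ? /andP[_ ?]; nra.
Qed.

End lower_tags.

(** Over the slice one inequality is [limit_le_Rintegral] for [h], and the other is the same lemma
    for the opposite of [h]. *)
Lemma Rintegral_stieltjes (h : \bar R -> R) (K l : R) :
  measurable_fun setT (h \o Y) -> (forall y, `|h y| <= K) ->
  real_stieltjes_sum h cdf @ @refinement R --> l ->
  \int[P]_w h (Y w) = h -oo%E * cdf -oo%E + l.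
Proof.
move=> mh hK hl; have hi A : measurable A -> P.-integrable A (EFin \o (h \o Y)).
  by move=> mA; apply: (integrable_bounded mA mh) => w; exact: hK.
(* No slice meets the event [Y = -oo], which contributes the first term. *)
have -> : [set: T] = [set w | (Y w <= -oo)%E] `|` slice -oo%E +oo%E.
  apply/seteqP; split=> // w _; rewrite /slice /= leey andbT.
  by case: (leP (Y w) -oo%E); [left|right].
rewrite Rintegral_setU//; last 2 first.
- by apply: hi; exact: measurableU.
- rewrite disj_set2E; apply/eqP/seteqP; split=> w //= [wy /andP[]].
  by rewrite ltNge wy.
congr (_ + _).
  transitivity (\int[P]_(w in [set w | (Y w <= -oo)%E]) h -oo%E).
    by apply: eq_Rintegral => w; rewrite inE /= leeNy_eq => /eqP ->.
  exact: Rintegral_cst.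
apply/eqP; rewrite eq_le (limit_le_Rintegral mh hK hl) andbT.
have mNh : measurable_fun setT ((fun y => - h y) \o Y).
  by apply/measurable_funN.
have NhK y : `|- h y| <= K by rewrite normrN.
have : real_stieltjes_sum (fun y => - h y) cdf @ @refinement R --> - l.
  rewrite (_ : real_stieltjes_sum _ _ = -%R \o real_stieltjes_sum h cdf).
    exact: cvgN.
  by apply/funext => st; exact: rsum_opp.
move=> /(limit_le_Rintegral mNh NhK).
rewrite (_ : (fun w => - h (Y w)) = (fun w => h (Y w) * -1)); last first.
  by apply/funext => w; rewrite mulrN1.
by rewrite RintegralZr ?mulrN1 ?lerN2//; exact: hi.
Qed.

End law_integral.

(** * Measurability of lattice polynomials and finiteness of the integrand *)

Lemma val_min (R : realType) (a b : \bar R) (x y : eitv a b) :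
  val (Order.min x y) = mine (val x) (val y).
Proof. by rewrite !minEle Order.le_val; case: ifP. Qed.

Lemma val_max (R : realType) (a b : \bar R) (x y : eitv a b) :
  val (Order.max x y) = maxe (val x) (val y).
Proof. by rewrite !maxEle Order.le_val; case: ifP. Qed.

Lemma measurable_wlp d (T : measurableType d) (R : realType) (a b : \bar R)
    (n : nat) (X : 'I_n -> T -> eitv a b)
    (mX : forall i, measurable_fun setT (fun w => val (X i w)))
    (p : ('I_n -> eitv a b) -> eitv a b) : wlp p ->
  measurable_fun setT (fun w => val (p (fun i => X i w))).
Proof.
elim=> [k|c|q r _ mq _ mr|q r _ mq _ mr].
- exact: mX.
- exact: measurable_cst.
- by under eq_fun do rewrite val_min; exact: measurable_mine.
- by under eq_fun do rewrite val_max; exact: measurable_maxe.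
Qed.

Lemma bounded_evariationP (R : realType) (g : \bar R -> \bar R) :
  bounded_evariation g ->
  exists (h : \bar R -> R) (K : R), g = EFin \o h /\ forall y, `|h y| <= K.
Proof.
case=> M gM; have le_M y : (`|g y - g -oo| <= M%:E)%E.
  (* The variation over [-oo], [y], [+oo] already contains this difference. *)
  have /gM : subdivision [:: y; +oo%E] by split=> //=; rewrite leNye leey.
  rewrite /evariation /node !big_ord_recl big_ord0 /= adde0.
  by apply: le_trans; rewrite leeDl.
(* If [g y] were infinite, the difference would have absolute value [+oo] whatever [g -oo] is. *)
have fg y : g y \is a fin_num.
  by have := le_M y; case: (g y) => [r||] //; case: (g -oo%E).
exists (fine \o g), (`|fine (g -oo%E)| + M); split.
  by apply/funext => y /=; rewrite fineK.
move=> y /=; have := le_M y.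
rewrite -(fineK (fg y)) -(fineK (fg -oo%E)) -EFinB /= lee_fin => le_y.
by rewrite -[X in `|X|](subrK (fine (g -oo%E))) addrC
  (le_trans (ler_normD _ _))// lerD2l.
Qed.

(** * The two formulas for the expected value *)

Local Open Scope ereal_scope.

Theorem proposition9 (d : measure_display) (T : measurableType d)
    (R : realType) (P : probability T R) (a b : \bar R) (hab : a <= b)
    (n : nat) (hn : (1 <= n)%N)
    (X : 'I_n -> T -> eitv a b)
    (mX : forall i, measurable_fun setT (fun w => val (X i w)))
    (indX : independent_family P (fun i w => val (X i w)))
    (p : ('I_n -> eitv a b) -> eitv a b) (hp : wlp p)
    (g : \bar R -> \bar R) (mg : measurable_fun setT g)
    (bvg : bounded_evariation g) :
  let F := fun i => ecdf P (fun w => val (X i w)) in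
  let Yp := fun w => val (p (fun i => X i w)) in
  let Fp := ecdf P Yp in
  ((forall i, g y%:E * (1 - F i y%:E) @[y --> +oo%R] --> 0) ->
    stieltjes_integrable g Fp \/
      stieltjes_integrable (fun y => 1 - Fp y) g ->
    [/\ stieltjes_integrable g Fp,
        stieltjes_integrable (fun y => 1 - Fp y) g,
        \int[P]_w g (Yp w) = stieltjes_cdf g Fp &
        \int[P]_w g (Yp w) = g -oo + stieltjes (fun y => 1 - Fp y) g]) /\
  ((forall i, g y%:E * F i y%:E @[y --> -oo%R] --> 0) ->
    stieltjes_integrable g Fp \/ stieltjes_integrable Fp g ->
    [/\ stieltjes_integrable g Fp,
        stieltjes_integrable Fp g,
        \int[P]_w g (Yp w) = stieltjes_cdf g Fp &
        \int[P]_w g (Yp w) = g +oo - stieltjes Fp g]).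
Proof.
move=> F Yp Fp.
have mYp : measurable_fun setT Yp := measurable_wlp mX hp.
have [h [K [gE hK]]] := bounded_evariationP bvg.
pose Fr y := fine (Fp y).
have FpE : Fp = EFin \o Fr.
  by apply/funext => y; rewrite /= fineK// ecdf_fin_num.
have FpCE : (fun y => 1 - Fp y) = EFin \o (fun y => 1 - Fr y)%R.
  by rewrite FpE; apply/funext => y; rewrite /= EFinB.
have Fr1 : Fr +oo = 1%R.
  rewrite /Fr /Fp /ecdf (_ : [set w | _] = setT) ?probability_setT//.
  by apply/seteqP; split=> // w _ /=; rewrite leey.
have mh : measurable_fun setT (h \o Yp).
  apply/measurable_EFinP; rewrite (_ : EFin \o _ = g \o Yp); last by rewrite gE.
  exact: measurableT_comp.
have bhF : bounded_sums h Fr.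
  exists (K * (Fr +oo%E - Fr -oo%E))%R => s t st ls; rewrite -ls.
  by apply: rsum_bound (tags_path st) => //; exact: fine_ecdf_homo.
(* Everything follows from convergence of the sums of [h] against [Fr]; each integrability
   hypothesis is brought back to it afterwards. *)
have conclusions (l : R) : real_stieltjes_sum h Fr @ @refinement R --> l ->
    [/\ stieltjes_integrable g Fp, stieltjes_integrable (fun y => 1 - Fp y) g,
        stieltjes_integrable Fp g, \int[P]_w g (Yp w) = stieltjes_cdf g Fp &
        \int[P]_w g (Yp w) = g -oo + stieltjes (fun y => 1 - Fp y) g /\
        \int[P]_w g (Yp w) = g +oo - stieltjes Fp g].
  (* Since [Fr +oo = 1], the sums of [Fr] against [h] tend to [h +oo - h -oo * Fr -oo - l], and
     those of [1 - Fr] to [h -oo * Fr -oo + l - h -oo]. *)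
  move=> hl; have Fl := real_stieltjes_cvg_parts hl.
  have [i1 e1] := cvg_stieltjes hl; have [i2 e2] := cvg_stieltjes Fl.
  have [i3 e3] := cvg_stieltjes (real_stieltjes_cvg_1sub Fl).
  have -> : \int[P]_w g (Yp w) = (h -oo%E * Fr -oo%E + l)%R%:E.
    rewrite -(Rintegral_stieltjes mYp mh hK hl) /Rintegral fineK ?gE//.
    apply: integrable_fin_num => //.
    exact: (integrable_bounded P measurableT mh (fun w => hK (Yp w))).
  rewrite /stieltjes_cdf FpCE gE FpE e1 e2 e3 Fr1; split=> //.
  by split; rewrite /= -?EFinB -?EFinD; congr _%:E; ring.
have of_hF : stieltjes_integrable g Fp ->
    exists l : R, real_stieltjes_sum h Fr @ @refinement R --> l.
  by rewrite gE FpE; exact: stieltjes_integrable_cvg bhF.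
have of_Fh : stieltjes_integrable Fp g ->
    exists l : R, real_stieltjes_sum h Fr @ @refinement R --> l.
  rewrite gE FpE => /(stieltjes_integrable_cvg (bounded_sumsC bhF))[l].
  by move/real_stieltjes_cvg_parts => hl; eexists; exact: hl.
have of_FCh : stieltjes_integrable (fun y => 1 - Fp y) g ->
    exists l : R, real_stieltjes_sum h Fr @ @refinement R --> l.
  rewrite gE FpCE.
  move=> /(stieltjes_integrable_cvg (bounded_sums_1sub (bounded_sumsC bhF)))[l].
  (* Complementing a second time returns to [Fr], and integration by parts then exchanges it with
     [h]. *)
  move/real_stieltjes_cvg_1sub/real_stieltjes_cvg_parts.
  have -> : (fun y => 1 - (1 - Fr y))%R = Fr.
    by apply/funext => y; rewrite opprB addrC subrK.
  by move=> hl; eexists; exact: hl.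
split=> _.
  by case=> [/of_hF|/of_FCh] [l /conclusions[? ? ? ? []]].
by case=> [/of_hF|/of_Fh] [l /conclusions[? ? ? ? []]].
Qed.
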